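(* Let $N\ge 2$ be even, let $R\ge 2$, and let $V=\{1,\dots,N\}$. There exist submodular functions $F_1^{\mathrm{lb}},\dots,F_R^{\mathrm{lb}}:2^V\to\mathbb R$ with $F_r^{\mathrm{lb}}(\emptyset)=0$ for all $r$ (the decomposition of $F^{\mathrm{lb}}=\sum_{r=1}^R F_r^{\mathrm{lb}}$) and an initialization $a_0\in\mathcal A$ such that the alternating projections sequences $b_k=\Pi_{\mathcal B^{\mathrm{lb}}}a_k$, $a_{k+1}=\Pi_{\mathcal A}b_k$ ($k\ge0$), with limits $a_*$ and $b_*$, have convergence rate at least $1-\frac{2\pi^2}{N^2R}$; that is, whenever $\alpha\in[0,1)$ and constants $C_1,C_2$ satisfy $\|a_k-a_*\|\le C_1\alpha^k$ and $\|b_k-b_*\|\le C_2\alpha^k$ for all $k\ge 0$, one has $\alpha\ge 1-\frac{2\pi^2}{N^2R}$. Here $\mathcal A=\{(a_1,\dots,a_R)\in\mathbb R^{NR} : \sum_{r=1}^R a_r=0\}$ (each $a_r\in\mathbb R^N$) and $\mathcal B^{\mathrm{lb}}=B(F_1^{\mathrm{lb}})\times\cdots\times B(F_R^{\mathrm{lb}})$.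
   Context: A set function $F:2^V\to\mathbb R$ is submodular if $F(A)+F(B)\ge F(A\cup B)+F(A\cap B)$ for all $A,B\subseteq V$. A vector $s\in\mathbb R^N$ is identified with the modular set function $s(A)=\sum_{n\in A}s_n$. The base polytope of $F$ is $B(F)=\{s\in\mathbb R^N : s(A)\le F(A)\text{ for all }A\subseteq V,\ s(V)=F(V)\}$. $\Pi_C z$ denotes the Euclidean projection of $z$ onto a nonempty closed convex set $C$; $\|\cdot\|$ is the Euclidean norm. Alternating projections (AP) is said to converge linearly with rate $\alpha<1$ if $\|a_k-a_*\|\le C_1\alpha^k$ and $\|b_k-b_*\|\le C_2\alpha^k$ for all $k$ and some constants $C_1,C_2$ (smaller $\alpha$ is better). *)

(* Defs.v *)
From HB Require Import structures.
From mathcomp Require Import all_boot all_order all_algebra.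
From mathcomp Require Import all_classical all_reals all_analysis.
Set Implicit Arguments.
Unset Strict Implicit.
Unset Printing Implicit Defensive.
Import Order.TTheory GRing.Theory Num.Theory.
Import numFieldNormedType.Exports.
Local Open Scope classical_set_scope.
Local Open Scope ring_scope.

(* The ground set {1, ..., N} is 'I_N, a point of K^N is a row vector, and a
   point (a_1, ..., a_M) of (K^N)^M is the M x N matrix whose r-th row is a_r. *)

Definition submodular (K : realType) (N : nat) (F : {set 'I_N} -> K) : Prop :=
  forall A B : {set 'I_N}, F (A :|: B) + F (A :&: B) <= F A + F B.

Definition modular (K : realType) (N : nat) (s : 'rV[K]_N) (A : {set 'I_N}) : K :=
  \sum_(n in A) s 0 n.

Definition base_polytope (K : realType) (N : nat) (F : {set 'I_N} -> K) :
    set 'rV[K]_N :=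
  [set s | (forall A : {set 'I_N}, modular s A <= F A)
           /\ modular s [set: 'I_N]%SET = F [set: 'I_N]%SET].

(* The norm `|_| that the library puts on matrices is the sup norm, hence a
   separate Euclidean norm. *)
Definition enorm (K : realType) (m n : nat) (x : 'M[K]_(m, n)) : K :=
  Num.sqrt (\sum_(i < m) \sum_(j < n) x i j ^+ 2).

(* p = \Pi_C z; as a relation, it includes the existence of the projection. *)
Definition is_proj (K : realType) (m n : nat) (C : set 'M[K]_(m, n))
    (z p : 'M[K]_(m, n)) : Prop :=
  C p /\ forall y : 'M[K]_(m, n), C y -> enorm (z - p) <= enorm (z - y).

Definition zero_sum (K : realType) (M N : nat) : set 'M[K]_(M, N) :=
  [set a | \sum_(r < M) row r a = 0].

Definition prod_base (K : realType) (M N : nat) (F : 'I_M -> {set 'I_N} -> K) :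
    set 'M[K]_(M, N) :=
  [set b | forall r : 'I_M, base_polytope (F r) (row r b)].

Definition is_AP (K : realType) (m n : nat) (A B : set 'M[K]_(m, n))
    (a0 : 'M[K]_(m, n)) (a b : nat -> 'M[K]_(m, n)) : Prop :=
  a 0%N = a0 /\
  forall k : nat, is_proj B (a k) (b k) /\ is_proj A (b k) (a k.+1).

Definition AP_linear_rate (K : realType) (m n : nat) (a b : nat -> 'M[K]_(m, n))
    (astar bstar : 'M[K]_(m, n)) (alpha : K) : Prop :=
  exists C1 C2 : K, forall k : nat,
    enorm (a k - astar) <= C1 * alpha ^+ k /\
    enorm (b k - bstar) <= C2 * alpha ^+ k.

(* Main.v *)
Require Import Defs.
From HB Require Import structures.
From mathcomp Require Import all_boot all_order all_algebra.
From mathcomp Require Import all_classical all_reals all_analysis.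
From mathcomp Require Import ring lra.
Import Order.TTheory GRing.Theory Num.Theory.
Import numFieldNormedType.Exports.
Local Open Scope classical_set_scope.
Local Open Scope ring_scope.

(** Place the ground set on a cycle of even length N. Its edges split into two
    perfect matchings, and the decomposition consists of the cut functions of
    these two matchings together with R - 2 zero functions.

    For an involution [T], a point of the base polytope of the cut function of
    the edges {n, T n} satisfies s (T n) = - s n ([base_cut_antisym]), and every
    such s with entries in [-1, 1] lies in the polytope ([antisym_base_cut]).
    Hence, near the origin, the product of the base polytopes is a linear
    subspace, and the projection onto it antisymmetrises each row under its
    involution ([is_proj_prod_base_cut]); the zero functions are the cuts of the
    identity. The projection onto the zero-sum space subtracts from each row the
    average of the rows ([is_proj_zero_sum]).

    Near the origin, the method therefore iterates a product of two linear
    projections, and its rate is governed by the angle between the two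
    subspaces. Sampling n |-> cos (2 pi n / N) along the cycle gives an explicit
    eigenvector of this product ([antisym_center_mode]) with eigenvalue
    1 - (1 - cos (2 pi / N)) / R, because the sampled cosine is an eigenvector
    of the adjacency matrix of the cycle ([node_neighbours]). Started from this
    eigenvector, centered, the iterates are geometric sequences tending to 0
    with exactly this ratio. No smaller ratio can bound them
    ([geometric_ratio_le]), and 1 - cos t <= t ^ 2 / 2 ([one_sub_cos_le]) gives
    the constant 2 pi ^ 2 / (N ^ 2 R). *)

(** * Euclidean projections *)

Section Projections.
Context {K : realType}.

Lemma is_proj_orthogonal {m n : nat} (C : set 'M[K]_(m, n)) (z p : 'M[K]_(m, n)) :
  C p ->
  (forall y, C y -> \sum_i \sum_j (z i j - p i j) * (p i j - y i j) = 0) ->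
  is_proj C z p.
Proof.
move=> Cp orth; split=> // y /orth orth_y; apply: ler_wsqrtr.
have -> : \sum_i \sum_j (z - y) i j ^+ 2 =
    \sum_i \sum_j (z - p) i j ^+ 2 + \sum_i \sum_j (p - y) i j ^+ 2 +
    2 * (\sum_i \sum_j (z i j - p i j) * (p i j - y i j)).
  rewrite mulr_sumr -!big_split /=; apply: eq_bigr => i _.
  rewrite mulr_sumr -!big_split /=; apply: eq_bigr => j _.
  by rewrite !mxE; ring.
rewrite orth_y mulr0 addr0 lerDl.
by apply: sumr_ge0 => i _; apply: sumr_ge0 => j _; rewrite sqr_ge0.
Qed.

Lemma zero_sumP {M N : nat} (a : 'M[K]_(M, N)) :
  zero_sum a <-> forall n, \sum_r a r n = 0.
Proof.
split=> [a0 n|a0].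
  move/rowP/(_ n): a0; rewrite summxE mxE => a0.
  by rewrite -[RHS]a0; apply: eq_bigr => r _; rewrite mxE.
apply/rowP => n; rewrite summxE mxE -[RHS](a0 n).
by apply: eq_bigr => r _; rewrite mxE.
Qed.

Definition center {M N : nat} (z : 'M[K]_(M, N)) : 'M[K]_(M, N) :=
  \matrix_(r, n) (z r n - (\sum_s z s n) / M%:R).

Lemma zero_sum_center {M N : nat} (z : 'M[K]_(M, N)) : zero_sum (center z).
Proof.
apply/zero_sumP => n; under eq_bigr do rewrite mxE.
case: M z => [|M] z; first by rewrite big_ord0.
by rewrite sumrB sumr_const card_ord -[X in _ - X]mulr_natr divfK ?pnatr_eq0 // subrr.
Qed.

(** What centering removes does not depend on the row, so it is orthogonal to
    every matrix whose rows sum to 0. *)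
Lemma is_proj_zero_sum {M N : nat} (z : 'M[K]_(M, N)) :
  is_proj (@zero_sum K M N) z (center z).
Proof.
apply: is_proj_orthogonal; first exact: zero_sum_center.
move=> y /zero_sumP y0.
have /zero_sumP c0 := zero_sum_center z.
rewrite exchange_big big1 // => n _ /=.
rewrite (eq_bigr (fun r =>
    (\sum_s z s n) / M%:R * (center z r n - y r n))).
  by rewrite -mulr_sumr sumrB c0 y0 subrr mulr0.
by move=> r _; congr (_ * _); rewrite mxE opprB addrC subrK.
Qed.

End Projections.

(** * Cut functions of matchings *)

Section Cuts.
Context {K : realType}.

(** The edges are the pairs {n, T n} for an involution [T]; each edge leaving
    [A] is counted once, at its endpoint in [A]. *)
Definition cut {N : nat} (T : 'I_N -> 'I_N) (A : {set 'I_N}) : K :=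
  \sum_(n in A) (T n \notin A)%:R.

Lemma submodular_cut {N : nat} (T : 'I_N -> 'I_N) : submodular (cut T).
Proof.
move=> A B; rewrite /cut !(big_mkcond (fun n => n \in _)).
rewrite -!big_split /=; apply: ler_sum => n _; rewrite !inE.
by case: (n \in A) (n \in B) (T n \in A) (T n \in B) => [] [] [] [] /=; lra.
Qed.

Lemma cut_set0 {N : nat} (T : 'I_N -> 'I_N) : cut T finset.set0 = 0.
Proof. by rewrite /cut big_set0. Qed.

Lemma cut_setT {N : nat} (T : 'I_N -> 'I_N) : cut T [set: 'I_N]%SET = 0.
Proof. by rewrite /cut big1 // => n _; rewrite inE. Qed.

(** An edge {n, T n} is not cut by itself, so s n + s (T n) <= 0 for every n,
    while these sums add up to 2 s(V) = 0. *)
Lemma base_cut_antisym {N : nat} (T : 'I_N -> 'I_N) (s : 'rV[K]_N) :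
  involutive T -> base_polytope (cut T) s -> forall n, s 0 (T n) = - s 0 n.
Proof.
move=> TK [sle]; rewrite cut_setT /modular => sV n.
have edge_le0 m : s 0 m + s 0 (T m) <= 0.
  have := sle [set m; T m]%SET; rewrite /cut [X in _ <= X]big1; last first.
    by move=> i; rewrite !inE => /orP[]/eqP->; rewrite ?TK eqxx ?orbT.
  rewrite /modular; have [<-|ne] := eqVneq m (T m).
    by rewrite finset.setUid big_set1; lra.
  by rewrite big_setU1 ?inE //= big_set1.
have total0 : \sum_m - (s 0 m + s 0 (T m)) = 0.
  have sumT : \sum_m s 0 (T m) = \sum_m s 0 m.
    by rewrite [RHS](reindex_inj (inv_inj TK)).
  have sum0 : \sum_m s 0 m = 0.
    by rewrite -[RHS]sV; apply: eq_bigl => m; rewrite inE.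
  by rewrite sumrN big_split /= sumT sum0 addr0 oppr0.
have := psumr_eq0P _ total0 (i := n) isT => /(_ _)/eqP.
rewrite oppr_eq0 addrC addr_eq0 => H; apply/eqP/H => m _.
by rewrite oppr_ge0.
Qed.

(** In s(A), the contributions of the two endpoints of an edge inside [A]
    cancel, which leaves one entry, at most 1, per edge leaving [A]. *)
Lemma antisym_base_cut {N : nat} (T : 'I_N -> 'I_N) (s : 'rV[K]_N) :
  involutive T -> (forall n, s 0 (T n) = - s 0 n) -> (forall n, `|s 0 n| <= 1) ->
  base_polytope (cut T) s.
Proof.
move=> TK sT s1.
have inside0 (A : {set 'I_N}) : \sum_(n in A | T n \in A) s 0 n = 0.
  set S := LHS; suff : S = - S by lra.
  rewrite {1}/S (reindex_inj (inv_inj TK)) /= -sumrN.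
  by apply: eq_big => n; rewrite ?TK 1?andbC // => _; rewrite sT.
have modularE A : modular s A = \sum_(n in A | T n \notin A) s 0 n.
  by rewrite /modular (bigID (fun n => T n \in A)) /= inside0 add0r.
split=> [A|]; rewrite modularE.
  rewrite /cut [leRHS](bigID (fun n => T n \notin A)) /=.
  rewrite [X in _ <= _ + X]big1 ?addr0; last by move=> n /andP[_ /negbTE->].
  apply: ler_sum => n /andP[_ ->]; exact: le_trans (ler_norm _) (s1 n).
by rewrite cut_setT big_pred0 // => n; rewrite !inE.
Qed.

Definition antisym {M N : nat} (T : 'I_M -> 'I_N -> 'I_N) (z : 'M[K]_(M, N)) :
    'M[K]_(M, N) :=
  \matrix_(r, n) ((z r n - z r (T r n)) / 2).

(** As long as the bounds on the entries do not bind, the projection is the one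
    onto the space of antisymmetric matrices: it removes the symmetric part
    of each row, which is orthogonal to all antisymmetric ones. *)
Lemma is_proj_prod_base_cut {M N : nat} (T : 'I_M -> 'I_N -> 'I_N)
    (z : 'M[K]_(M, N)) :
  (forall r, involutive (T r)) -> (forall r n, `|antisym T z r n| <= 1) ->
  is_proj (prod_base (fun r => cut (T r))) z (antisym T z).
Proof.
move=> TK z1.
have pT r n : antisym T z r (T r n) = - antisym T z r n.
  by rewrite !mxE TK; ring.
apply: is_proj_orthogonal => [r|y By].
  have rowE n : row r (antisym T z) 0 n = antisym T z r n by rewrite mxE.
  by apply: antisym_base_cut => // n; rewrite !rowE.
rewrite big1 // => r _.
have yT n : y r (T r n) = - y r n.
  by have := base_cut_antisym _ _ (TK r) (By r) n; rewrite !mxE.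
set S := LHS; suff : S = - S by lra.
rewrite {1}/S (reindex_inj (inv_inj (TK r))) /= -sumrN.
apply: eq_bigr => n _; rewrite yT pT !mxE.
by field.
Qed.

End Cuts.

(** * Trigonometric and geometric estimates *)

Section Estimates.
Context {K : realType}.

Lemma sin_le_id (x : K) : 0 <= x -> sin x <= x.
Proof.
move=> x0.
have cont : {within `[0, x], continuous (@sin K)}.
  by apply: continuous_subspaceT => y; exact: continuous_sin.
have [c _] := MVT_segment x0 (fun y _ => is_derive_sin y) cont.
by rewrite sin0 !subr0 => ->; rewrite ler_piMl // cos_le1.
Qed.

Lemma one_sub_cos_le (x : K) : 0 <= x <= 2 * pi -> 1 - cos x <= x ^+ 2 / 2.
Proof.
move=> /andP[x0 x2pi]; set y := x / 2.
have y0 : 0 <= y by rewrite /y; lra.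
have siny0 : 0 <= sin y by apply: sin_ge0_pi; rewrite /y; lra.
have xE : x = y *+ 2 by rewrite /y mulr2n; field.
have : sin y ^+ 2 <= y ^+ 2 by rewrite ler_sqr ?nnegrE // sin_le_id.
have -> : x ^+ 2 = 4 * y ^+ 2 by rewrite /y; field.
rewrite xE cos_mulr2n cos2sin2 mulr2n; lra.
Qed.

Lemma geometric_ratio_le (c C lam alpha : K) :
  0 < c -> 0 < lam -> 0 <= alpha ->
  (forall k : nat, c * lam ^+ k <= C * alpha ^+ k) -> lam <= alpha.
Proof.
move=> c0 lam0 alpha0 bound; rewrite leNgt; apply/negP => lt_alpha.
have q1 : `|alpha / lam| < 1.
  by rewrite ger0_norm ?divr_ge0 ?(ltW lam0) // ltr_pdivrMr // mul1r.
suff : c <= 0 by rewrite leNgt c0.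
apply: (ler_cvg_to (cvg_cst c) (cvg_geometric C q1)); apply: nearW => k /=.
by rewrite expr_div_n mulrA ler_pdivlMr ?exprn_gt0.
Qed.

End Estimates.

(** * The matchings of the cycle and their common eigenvector *)

Section Cycle.
Context {K : realType} {N : nat}.
Hypothesis N_gt0 : (0 < N)%N.
Hypothesis N_even : ~~ odd N.

Lemma odd_ordS (n : 'I_N) : odd (ordS n) = ~~ odd n.
Proof. by rewrite /= odd_mod ?(negbTE N_even). Qed.

Lemma odd_ord_pred (n : 'I_N) : odd (ord_pred n) = ~~ odd n.
Proof. by rewrite -[in RHS](ord_predK n) odd_ordS negbK. Qed.

(** The edge at an even point goes forward when [b] is false and backward when
    [b] is true. *)
Definition matching (b : bool) (n : 'I_N) : 'I_N :=
  if odd n (+) b then ord_pred n else ordS n.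

Lemma odd_matching b (n : 'I_N) : odd (matching b n) = ~~ odd n.
Proof. by rewrite /matching; case: ifP; rewrite ?odd_ord_pred ?odd_ordS. Qed.

Lemma matchingK b : involutive (matching b).
Proof.
move=> n; rewrite {1}/matching odd_matching addNb /matching.
by case: (odd n (+) b) => /=; rewrite ?ordSK ?ord_predK.
Qed.

Definition angle : K := 2 * pi / N%:R.

Definition node (n : 'I_N) : K := cos (angle * n%:R).

Lemma cos_angle_mod (m : nat) : cos (angle * (m %% N)%:R) = cos (angle * m%:R).
Proof.
have N0 : N%:R != 0 :> K by rewrite pnatr_eq0 -lt0n.
rewrite -(periodicn (@cosD2pi K) (m %/ N)); congr cos.
rewrite [in RHS](divn_eq m N) natrD natrM -[_ *+ (m %/ N)]mulr_natr mulr2n /angle.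
by field.
Qed.

(** Sum formula for the cosines of the angles t + [angle] and t - [angle]. *)
Lemma node_neighbours (n : 'I_N) :
  node (ord_pred n) + node (ordS n) = 2 * cos angle * node n.
Proof.
have N0 : N%:R != 0 :> K by rewrite pnatr_eq0 -lt0n.
rewrite /node /= !cos_angle_mod.
have -> : angle * (n + N).-1%:R = (angle * n%:R - angle) + pi *+ 2.
  rewrite -subn1 natrB ?addn_gt0 ?N_gt0 ?orbT // natrD /angle mulr2n.
  by field.
rewrite cosD2pi -natr1 mulrDr mulr1 cosB cosD.
by ring.
Qed.

Lemma matching_neighbours b (n : 'I_N) :
  node (matching b n) + node (matching (~~ b) n) = 2 * cos angle * node n.
Proof.
rewrite -node_neighbours /matching addbN.
by case: (odd n (+) b) => /=; rewrite // addrC.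
Qed.

(** Each edge of matching [b] carries the value of [node] at one of its
    endpoints, even for the first matching and odd for the second, and the
    opposite value at the other. *)
Definition wave (b : bool) (n : 'I_N) : K :=
  if odd n (+) b then - node (matching b n) else node n.

Lemma wave_matching b (n : 'I_N) : wave b (matching b n) = - wave b n.
Proof.
rewrite /wave odd_matching matchingK addNb.
by case: (odd n (+) b) => //=; rewrite opprK.
Qed.

Lemma wave_norm_le1 b n : `|wave b n| <= 1.
Proof. by rewrite /wave; case: ifP => _; rewrite ?normrN cos_max. Qed.

(** The cosine of the angle between the two antisymmetric subspaces:
    antisymmetrising one wave under the other matching multiplies it by
    - cos [angle]. *)
Lemma wave_other_matching b n :
  wave (~~ b) n - wave (~~ b) (matching b n) = - 2 * cos angle * wave b n.
Proof.
rewrite /wave odd_matching !addbN addNb negbK.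
case: (odd n (+) b) => /=.
  have := matching_neighbours b (matching b n); rewrite matchingK; lra.
by have := matching_neighbours b n; lra.
Qed.

Lemma total_wave_antisym b n :
  (wave false n + wave true n) -
    (wave false (matching b n) + wave true (matching b n)) =
  2 * (1 - cos angle) * wave b n.
Proof.
have := wave_matching b n; have := wave_other_matching b n.
by case: b => /=; lra.
Qed.

Definition partner (r : nat) : 'I_N -> 'I_N :=
  match r with 0 => matching false | 1 => matching true | _ => id end.

Lemma partnerK r : involutive (partner r).
Proof. by case: r => [|[|r]] //=; exact: matchingK. Qed.

Definition mode {M : nat} : 'M[K]_(M, N) :=
  \matrix_(r, n) match r : nat with
    0 => wave false n | 1 => wave true n | _ => 0 end.

Lemma mode_norm_le1 {M : nat} (r : 'I_M) n : `|mode r n| <= 1.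
Proof.
by rewrite mxE; case: (r : nat) => [|[|?]]; rewrite ?wave_norm_le1 ?normr0.
Qed.

Lemma sum_mode {M : nat} n :
  \sum_(r < M.+2) mode r n = wave false n + wave true n.
Proof.
rewrite !big_ord_recl !mxE /= big1 ?addr0 // => r _.
by rewrite !mxE.
Qed.

Definition rate (M : nat) : K := 1 - (1 - cos angle) / M%:R.

Lemma antisym_center_mode {M : nat} :
  antisym (fun r : 'I_M.+2 => partner r) (center mode) = rate M.+2 *: mode.
Proof.
have M0 : M.+2%:R != 0 :> K by rewrite pnatr_eq0.
have eigen b n (w := wave b n) (S := fun m => wave false m + wave true m) :
    (w - S n / M.+2%:R - (wave b (matching b n) - S (matching b n) / M.+2%:R)) / 2
    = (1 - (1 - cos angle) / M.+2%:R) * w.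
  have SE : S n = S (matching b n) + 2 * (1 - cos angle) * w.
    by rewrite -total_wave_antisym addrC subrK.
  by rewrite SE wave_matching -/w; field.
apply/matrixP => r n; rewrite !mxE !sum_mode /rate.
case: (r : nat) => [|[|k]] /=; [exact: eigen | exact: eigen |].
by rewrite subrr mul0r mulr0.
Qed.

End Cycle.

Arguments angle : clear implicits.
Arguments rate : clear implicits.

(** * The rate of convergence *)

Section Linearity.
Context {K : realType} {M N : nat}.

Lemma centerZ (l : K) (z : 'M[K]_(M, N)) : center (l *: z) = l *: center z.
Proof.
apply/matrixP => r n; rewrite !mxE.
under eq_bigr do rewrite mxE.
by rewrite -mulr_sumr mulrBr mulrA.
Qed.

Lemma antisymZ (T : 'I_M -> 'I_N -> 'I_N) (l : K) (z : 'M[K]_(M, N)) :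
  antisym T (l *: z) = l *: antisym T z.
Proof. by apply/matrixP => r n; rewrite !mxE mulrA mulrBr. Qed.

Lemma enormZ (l : K) (z : 'M[K]_(M, N)) :
  0 <= l -> enorm (l *: z) = l * enorm z.
Proof.
move=> l0; rewrite /enorm -[X in _ = X * _](ger0_norm l0) -sqrtr_sqr.
rewrite -sqrtrM ?sqr_ge0 // mulr_sumr; congr Num.sqrt.
apply: eq_bigr => i _; rewrite mulr_sumr; apply: eq_bigr => j _.
by rewrite mxE exprMn.
Qed.

Lemma enorm_gt0 (z : 'M[K]_(M, N)) i j : z i j != 0 -> 0 < enorm z.
Proof.
move=> zij; rewrite sqrtr_gt0 (bigD1 i) //= (bigD1 j) //= -addrA.
apply: ltr_pwDl; first by rewrite exprn_even_gt0.
apply: addr_ge0; first by apply: sumr_ge0 => *; rewrite sqr_ge0.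
by apply: sumr_ge0 => *; apply: sumr_ge0 => *; rewrite sqr_ge0.
Qed.

Lemma cvg_geometric_mx (l : K) (z : 'M[K]_(M, N)) :
  0 <= l < 1 -> (fun k => l ^+ k *: z) @ \oo --> (0 : 'M[K]_(M, N)).
Proof.
move=> /andP[l0 l1]; rewrite -(scale0r z).
by apply: cvgZr_tmp; apply: cvg_expr; rewrite ger0_norm.
Qed.

End Linearity.

Section Rate.
Context {K : realType} {N : nat}.
Hypothesis N_ge2 : (2 <= N)%N.

Lemma angle_bounds : 0 < angle K N <= pi.
Proof.
have N0 : 0 < N%:R :> K by rewrite ltr0n (ltn_trans _ N_ge2).
have pi0 := pi_gt0 K.
rewrite /angle divr_gt0 ?mulr_gt0 //= ler_pdivrMr // mulrC ler_pM2l //.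
by rewrite ler_nat.
Qed.

(** Nonnegativity holds because 1 - cos t <= 2 and there are at least two
    summands. *)
Lemma rate_bounds M : 0 <= rate K N M.+2 < 1.
Proof.
have M0 : 0 < M.+2%:R :> K by rewrite ltr0n.
have /andP[t0 tpi] := angle_bounds.
have cos_lt1 : cos (angle K N) < 1.
  by rewrite -(cos0 K) ltr_cos ?in_itv /= ?lexx ?pi_ge0 // ltW.
rewrite /rate subr_ge0 ler_pdivrMr // mul1r gtrBl divr_gt0 ?subr_gt0 // andbT.
have : 2 <= M.+2%:R :> K by rewrite ler_nat.
have := cos_geN1 (angle K N); lra.
Qed.

Lemma rate_ge M :
  1 - 2 * pi ^+ 2 / (N%:R ^+ 2 * M%:R) <= rate K N M.
Proof.
rewrite /rate lerD2l lerN2 invfM mulrA.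
apply: ler_wpM2r; first by rewrite invr_ge0.
have /andP[t0 tpi] := angle_bounds.
have N0 : N%:R != 0 :> K by rewrite pnatr_eq0 -lt0n (ltn_trans _ N_ge2).
apply: (@le_trans _ _ (angle K N ^+ 2 / 2)).
  by apply: one_sub_cos_le; lra.
suff -> : angle K N ^+ 2 / 2 = 2 * pi ^+ 2 / N%:R ^+ 2 by [].
by rewrite /angle; field.
Qed.

End Rate.

Theorem theorem14 (K : realType) (N R : nat)
    (hN : (2 <= N)%N) (hNeven : ~~ odd N) (hR : (2 <= R)%N) :
  exists F : 'I_R -> {set 'I_N} -> K,
    (forall r : 'I_R, submodular (F r) /\ F r finset.set0 = 0) /\
    exists a0 : 'M[K]_(R, N),
      zero_sum a0 /\
      exists (a b : nat -> 'M[K]_(R, N)) (astar bstar : 'M[K]_(R, N)),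
        is_AP (@zero_sum K R N) (prod_base F) a0 a b /\
        a @ \oo --> astar /\
        b @ \oo --> bstar /\
        (forall alpha : K, 0 <= alpha < 1 ->
           AP_linear_rate a b astar bstar alpha ->
           1 - 2 * pi ^+ 2 / (N%:R ^+ 2 * R%:R) <= alpha).
Proof.
have N0 : (0 < N)%N by apply: ltn_trans hN.
case: R hR => [|[|M]] // _.
set T := fun r : 'I_M.+2 => @partner N r.
set E : 'M[K]_(M.+2, N) := mode.
set lam : K := rate K N M.+2.
have /andP[lam0 lam1] : 0 <= lam < 1 := rate_bounds hN M.
have TK r : involutive (T r) by exact: partnerK.
have antisym_center k : antisym T (lam ^+ k *: center E) = lam ^+ k.+1 *: E.
  by rewrite antisymZ (antisym_center_mode N0 hNeven) scalerA exprSr.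
exists (fun r => cut (T r)); split.
  by move=> r; split; [exact: submodular_cut | exact: cut_set0].
exists (center E); split; first exact: zero_sum_center.
exists (fun k => lam ^+ k *: center E), (fun k => lam ^+ k.+1 *: E), 0, 0.
split; [split | split; [|split]].
- by rewrite expr0 scale1r.
- move=> k; split; last by rewrite -centerZ; exact: is_proj_zero_sum.
  rewrite -antisym_center; apply: is_proj_prod_base_cut => // r n.
  rewrite antisym_center mxE normrM ger0_norm ?exprn_ge0 //.
  by rewrite mulr_ile1 ?exprn_ge0 ?exprn_ile1 ?mode_norm_le1 // ltW.
- by apply: cvg_geometric_mx; rewrite lam0.
- rewrite -(scale0r E); under eq_fun do rewrite exprS mulrC -scalerA.
  by rewrite scale0r; apply: cvg_geometric_mx; rewrite lam0.
move=> alpha /andP[alpha0 _] [C1 [C2 bound]].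
apply: le_trans (rate_ge hN _) _; rewrite -/lam.
have [->|lam_neq0] := eqVneq lam 0; first by [].
have lam_gt0 : 0 < lam by rewrite lt_neqAle eq_sym lam_neq0.
(* The first matching carries cos 0 = 1 at the point 0. *)
have E_gt0 : 0 < enorm E.
  apply: (@enorm_gt0 _ _ _ _ ord0 (Ordinal N0)).
  by rewrite mxE /wave /node /= mulr0 cos0 oner_neq0.
apply: (geometric_ratio_le (lam * enorm E) C2); rewrite ?mulr_gt0 // => k.
have [_] := bound k.
by rewrite subr0 enormZ ?exprn_ge0 // exprS mulrAC.
Qed.
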